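(* Let $p$ be a prime and let $G$ and $H$ be finite noncyclic powerful $p$-groups. Then $\sigma_P(G \times H) \leq \min \left(\sigma_P(G), \sigma_P(H) \right)$.
   Context: For a group $G$ and a positive integer $k$, $G^k$ denotes the subgroup generated by $\{g^k \mid g\in G\}$, and $[G,G]$ is the commutator subgroup. A finite $p$-group $G$ ($p$ prime) is called powerful if either $p$ is odd and $[G,G]\subseteq G^p$, or $p=2$ and $[G,G]\subseteq G^4$. A cover of a group $G$ is a collection of proper subgroups of $G$ whose union is $G$. A powerful cover of a finite $p$-group $G$ is a cover of $G$ all of whose members are powerful groups. The powerful covering number $\sigma_P(G)$ of a finite noncyclic $p$-group $G$ is the smallest number of subgroups in a powerful cover of $G$. *)

(* Defs.v *)
From mathcomp Require Import all_boot all_fingroup all_solvable.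

Set Implicit Arguments.
Unset Strict Implicit.
Unset Printing Implicit Defensive.

Local Open Scope group_scope.

Section Powerful.

Variables (gT : finGroupType) (p : nat).
Implicit Types (G : {group gT}) (C : {set {group gT}}).

Definition power_subgroup (k : nat) (G : {group gT}) : {group gT} :=
  [group of <<[set x ^+ k | x in G]>>].

Definition powerful (G : {group gT}) : bool :=
  p.-group G &&
  (odd p && ([~: G, G] \subset power_subgroup p G)
   || (p == 2) && ([~: G, G] \subset power_subgroup 4 G)).

Definition group_cover (G : {group gT}) (C : {set {group gT}}) : bool :=
  [forall K in C, K \proper G] && (\bigcup_(K in C) (K : {set gT}) == G).

Definition powerful_cover (G : {group gT}) (C : {set {group gT}}) : bool :=
  group_cover G C && [forall K in C, powerful K].

Definition cyclic_subgroups (G : {group gT}) : {set {group gT}} :=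
  [set <[x]>%G | x in G].

(* The starting point of the arg min is itself a powerful cover when G is a
   noncyclic p-group (cyclic_subgroups_powerful_cover), so the minimum is
   genuine in that case; for other G the value carries no meaning. *)
Definition powerful_covering_number (G : {group gT}) : nat :=
  #|[arg min_(C < cyclic_subgroups G | powerful_cover G C) #|C|]|.

Lemma cyclic_subgroups_powerful_cover G :
  prime p -> p.-group G -> ~~ cyclic G ->
  powerful_cover G (cyclic_subgroups G).
Proof.
move=> p_pr pG ncG; apply/andP; split; first (apply/andP; split).
- apply/forall_inP=> _ /imsetP[x Gx ->] /=.
  rewrite properEneq cycle_subG Gx andbT; move: ncG.
  by apply: contra => /eqP <-; apply: cycle_cyclic.
- rewrite eqEsubset; apply/andP; split.
    by apply/bigcupsP=> _ /imsetP[x Gx ->]; rewrite cycle_subG.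
  apply/subsetP=> x Gx; apply/bigcupP; exists <[x]>%G; last exact: cycle_id.
  exact: imset_f.
- apply/forall_inP=> _ /imsetP[x Gx ->]; apply/andP; split.
    by apply: pgroupS pG; rewrite cycle_subG.
  have /commG1P -> : abelian <[x]> by apply: cycle_abelian.
  by rewrite !sub1G !andbT; case: (even_prime p_pr) => ->.
Qed.

Lemma powerful_covering_numberP G :
  prime p -> p.-group G -> ~~ cyclic G ->
  (exists2 C, powerful_cover G C & #|C| = powerful_covering_number G)
  /\ (forall C, powerful_cover G C -> powerful_covering_number G <= #|C|).
Proof.
move=> p_pr pG ncG; rewrite /powerful_covering_number.
case: arg_minnP => [|C covC minC]; first exact: cyclic_subgroups_powerful_cover.
by split; first exists C.
Qed.

End Powerful.

(* Main.v *)
Require Import Defs.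
From mathcomp Require Import all_boot all_fingroup all_solvable.

(** Powerful covers pull back along the projections of G x H. If the powerful
    groups K cover G, then the products K x H are proper subgroups covering
    G x H, and there are at most as many of them. They are powerful because a
    direct product of powerful groups is powerful ([powerful_setX]): a
    commutator ([a, c], [b, d]) is the product of ([a, c], 1) and (1, [b, d]),
    and the two factor embeddings send k-th powers to k-th powers. This gives
    the bound by the covering number of G; the bound by that of H comes from
    the other projection. Both are instances of
    [leq_powerful_covering_number], which concerns an arbitrary surjection
    under which powerful proper subgroups have powerful preimages. *)

Section PowerfulCovers.

Set Implicit Arguments.
Unset Strict Implicit.
Unset Printing Implicit Defensive.

Local Open Scope group_scope.

Variable p : nat.
Hypothesis p_pr : prime p.

(** Merging the odd and even cases into one exponent lets the product and its
    factors be compared without a case analysis on p. *)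
Lemma powerfulE (gT : finGroupType) (G : {group gT}) :
  powerful p G
    = p.-group G
      && ([~: G, G] \subset power_subgroup (if odd p then p else 4) G).
Proof.
by rewrite /powerful; case: (even_prime p_pr) => [-> | p_odd] //=;
   rewrite p_odd; case: eqP p_odd => [-> //| _] _; rewrite orbF.
Qed.

Lemma morphim_power_subgroup (aT rT : finGroupType) (D : {group aT})
    (f : {morphism D >-> rT}) (k : nat) (A : {group aT}) (B : {group rT}) :
  A \subset D -> f @* A \subset B ->
  f @* power_subgroup k A \subset power_subgroup k B.
Proof.
move=> sAD sfAB.
have sPD : [set x ^+ k | x in A] \subset D.
  by apply/subsetP=> _ /imsetP[x Ax ->]; rewrite groupX // (subsetP sAD).
rewrite /= morphim_gen // gen_subG.
apply/subsetP=> _ /morphimP[_ _ /imsetP[x Ax ->] ->].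
have Dx := subsetP sAD x Ax.
rewrite morphX //; apply: mem_gen; apply: (imset_f (fun y => y ^+ k)).
by rewrite (subsetP sfAB) // mem_morphim.
Qed.

Lemma commg_setX_sub_power (gT hT : finGroupType) (k : nat)
    (K : {group gT}) (L : {group hT}) :
  [~: K, K] \subset power_subgroup k K ->
  [~: L, L] \subset power_subgroup k L ->
  [~: setX K L, setX K L] \subset power_subgroup k [group of setX K L].
Proof.
move=> sK sL; rewrite gen_subG.
apply/subsetP=> _ /imset2P[[a b] [c d] /setXP[/= Ka Lb] /setXP[/= Kc Ld] ->].
have -> : [~ (a, b), (c, d)] = pairg1 hT [~ a, c] * pair1g gT [~ b, d].
  by rewrite -[RHS]/(_, _) /= mulg1 mul1g.
apply: groupM.
- have sKX : pairg1 hT @* K \subset [group of setX K L].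
    by rewrite morphim_pairg1 setXS ?sub1G.
  apply: (subsetP (morphim_power_subgroup k (subsetT K) sKX)).
  by rewrite mem_morphim ?inE // (subsetP sK) ?mem_commg.
- have sLX : @pair1g gT hT @* L \subset [group of setX K L].
    by rewrite morphim_pair1g setXS ?sub1G.
  apply: (subsetP (morphim_power_subgroup k (subsetT L) sLX)).
  by rewrite mem_morphim ?inE // (subsetP sL) ?mem_commg.
Qed.

Lemma pgroup_setX (gT hT : finGroupType) (K : {group gT}) (L : {group hT}) :
  p.-group K -> p.-group L -> p.-group (setX K L).
Proof. by move=> pK pL; rewrite /pgroup cardsX pnatM; apply/andP. Qed.

Lemma powerful_setX (gT hT : finGroupType) (K : {group gT}) (L : {group hT}) :
  powerful p K -> powerful p L -> powerful p [group of setX K L].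
Proof.
rewrite !powerfulE => /andP[pK sK] /andP[pL sL].
by rewrite pgroup_setX ?commg_setX_sub_power.
Qed.

(** The preimages in X of the members of a minimal powerful cover of f @* X
    cover X. They remain proper because f maps X onto the whole image, so a
    member whose preimage is X would be the image itself. *)
Lemma leq_powerful_covering_number (aT rT : finGroupType) (D : {group aT})
    (f : {morphism D >-> rT}) (X : {group aT}) (G : {group rT}) :
  X \subset D -> f @* X = G -> p.-group X -> ~~ cyclic G ->
  (forall K : {group rT}, K \proper G -> powerful p K ->
     powerful p (X :&: f @*^-1 K)%G) ->
  powerful_covering_number p X <= powerful_covering_number p G.
Proof.
move=> sXD defG pX ncG powK.
have pG : p.-group G by rewrite -defG morphim_pgroup.
have ncX : ~~ cyclic X.
  by apply: contra ncG => cX; rewrite -defG morphim_cyclic.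
have [[C /andP[/andP[/forall_inP prC /eqP covC] /forall_inP powC] <-] _] :=
  powerful_covering_numberP p_pr pG ncG.
have [_ minX] := powerful_covering_numberP p_pr pX ncX.
pose pull (K : {group rT}) := (X :&: f @*^-1 K)%G.
apply: leq_trans (leq_imset_card pull C); apply: minX.
apply/andP; split; last first.
  by apply/forall_inP=> _ /imsetP[K CK ->]; rewrite powK ?prC ?powC.
apply/andP; split.
  apply/forall_inP=> _ /imsetP[K CK ->].
  rewrite properE subsetIl subsetI subxx /= -sub_morphim_pre // defG.
  exact: proper_subn (prC K CK).
rewrite eqEsubset; apply/andP; split.
  by apply/bigcupsP=> _ /imsetP[K CK ->]; apply: subsetIl.
apply/subsetP=> x Xx; have Dx := subsetP sXD x Xx.
have: f x \in G by rewrite -defG mem_morphim.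
rewrite -covC => /bigcupP[K CK Kfx].
apply/bigcupP; exists (pull K); first exact: imset_f.
by rewrite inE Xx mem_morphpre.
Qed.

End PowerfulCovers.

Theorem theorem3p6 (p : nat) (gT hT : finGroupType)
    (G : {group gT}) (H : {group hT}) :
  prime p ->
  powerful p G -> ~~ cyclic G ->
  powerful p H -> ~~ cyclic H ->
  powerful_covering_number p [group of setX G H]
    <= minn (powerful_covering_number p G) (powerful_covering_number p H).
Proof.
move=> p_pr powG ncG powH ncH.
have pX : pgroup p (setX G H).
  by apply: pgroup_setX; [case/andP: powG | case/andP: powH].
rewrite leq_min; apply/andP; split.
- apply: (@leq_powerful_covering_number p p_pr _ _ _
            (fst_morphism gT hT) [group of setX G H] G);
    rewrite ?subsetT ?morphim_fstX //.
  move=> K /proper_sub sKG powK.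
  suff -> : ([group of setX G H] :&: fst_morphism gT hT @*^-1 K)%G
            = [group of setX K H] by apply: powerful_setX.
  apply/val_inj/setP=> -[x y]; rewrite !inE /= andbAC; congr (_ && _).
  by apply/andb_idl/(subsetP sKG).
- apply: (@leq_powerful_covering_number p p_pr _ _ _
            (snd_morphism gT hT) [group of setX G H] H);
    rewrite ?subsetT ?morphim_sndX //.
  move=> K /proper_sub sKH powK.
  suff -> : ([group of setX G H] :&: snd_morphism gT hT @*^-1 K)%G
            = [group of setX G K] by apply: powerful_setX.
  apply/val_inj/setP=> -[x y]; rewrite !inE /= -andbA; congr (_ && _).
  by apply/andb_idl/(subsetP sKH).
Qed.
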